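(* Let $u$ be a quasi-definite moment functional on $\mathcal{P}=\mathbb{R}[x_1,\dots,x_d]$, and let $\{\mathbb{P}_n\}_{n\ge 0}$ be a weak orthogonal polynomial system (WOPS) with respect to $u$. Then $u$ is semiclassical if and only if the gradients of $\{\mathbb{P}_n\}_{n\ge0}$ satisfy a quasi-orthogonality relation, in the following precise sense. (i) If $u$ is semiclassical, with polynomial matrices $\Phi,\Psi$ as in the definition of semiclassical functional (so $\operatorname{div}(\Phi u)=\Psi^t u$, $\Phi$ is symmetric, $\deg\Phi=p\ge 0$, $\deg\Psi=q\ge1$, $\det\langle u,\Phi\rangle\ne0$) and $s=\max\{p-2,q-1\}$, then for every $n\ge s+1$ $$\langle u,\ (\nabla \mathbb{P}_m^t)^t\,\Phi\,\nabla\mathbb{P}_n^t\rangle = 0,\qquad 0\le m<n-s .$$ (ii) Conversely, if there exist a symmetric $d\times d$ polynomial matrix $\Phi$ with $\deg\Phi=p\ge0$ and $\det\langle u,\Phi\rangle\neq0$, and an integer $s\ge\max\{p-2,0\}$, such that for every $n\ge s+1$ $$\langle u,\ (\nabla \mathbb{P}_m^t)^t\,\Phi\,\nabla\mathbb{P}_n^t\rangle = 0,\qquad 0\le m<n-s ,$$ then $u$ is semiclassical.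
   Context: Polynomials and functionals. $\mathcal{P}$ is the space of real polynomials in $d$ variables $x_1,\dots,x_d$, $\mathcal{P}_n$ the subspace of polynomials of total degree at most $n$, and $r_n=\binom{n+d-1}{n}$ is the dimension of the space of homogeneous polynomials of degree $n$. A moment functional is a linear functional $u:\mathcal{P}\to\mathbb{R}$, $f\mapsto\langle u,f\rangle$; for a matrix $M$ of polynomials, $\langle u,M\rangle$ denotes the real matrix obtained by applying $u$ entrywise. The degree of a polynomial matrix is the maximum of the degrees of its entries. Polynomial systems. For each $n\ge0$, $\mathbb{P}_n$ is an $r_n\times1$ column vector whose entries are polynomials of total degree $n$; $\{\mathbb{P}_n\}_{n\ge0}$ is a polynomial system if, for each $n$, the entries of $\mathbb{P}_0,\dots,\mathbb{P}_n$ form a basis of $\mathcal{P}_n$. A polynomial system is a weak orthogonal polynomial system (WOPS) with respect to $u$ if $\langle u,\mathbb{P}_n\mathbb{P}_m^t\rangle=0$ for $m\ne n$ and $\langle u,\mathbb{P}_n\mathbb{P}_n^t\rangle=H_n$ is a nonsingular $r_n\times r_n$ matrix for every $n$. The functional $u$ is quasi-definite if there exists a WOPS with respect to $u$. Gradient. For $f\in\mathcal{P}$, $\nabla f=(\partial_1 f,\dots,\partial_d f)^t$. For the row vector $\mathbb{P}_n^t$, $\nabla\mathbb{P}_n^t$ is the $d\times r_n$ matrix whose $i$-th row is $\partial_i\mathbb{P}_n^t$; $(\nabla\mathbb{P}_m^t)^t$ is its ($r_m\times d$) transpose. Semiclassical functional. A quasi-definite moment functional $u$ is semiclassical if there exist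 a symmetric $d\times d$ polynomial matrix $\Phi$ with $\deg\Phi=p\ge0$ and a $d\times1$ polynomial matrix $\Psi$ with $\deg\Psi=q\ge1$ such that $\det\langle u,\Phi\rangle\ne0$ and the matrix Pearson-type equation $\operatorname{div}(\Phi u)=\Psi^t u$ holds, meaning $$\langle u,\ \Phi\,\nabla f+\Psi f\rangle=0\in\mathbb{R}^d\quad\text{for all } f\in\mathcal{P}.$$ One sets $s=\max\{p-2,q-1\}\ge0$. *)

(* Defs.v *)
From mathcomp Require Import all_boot all_algebra.
From mathcomp Require Import reals.
From mathcomp Require Import mpoly.

Set Implicit Arguments.
Unset Strict Implicit.
Unset Printing Implicit Defensive.

Import GRing.Theory.
Local Open Scope ring_scope.

Definition is_basis (R : realType) (V : lmodType R) (I : finType)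
    (S : V -> Prop) (b : I -> V) : Prop :=
  [/\ forall i, S (b i),
      forall c : I -> R, \sum_i c i *: b i = 0 -> forall i, c i = 0
    & forall v, S v -> exists c : I -> R, v = \sum_i c i *: b i].

(* [msize f] is the total degree of [f] plus one, and [msize 0 = 0]. *)
Definition poly_deg_le (R : realType) (d n : nat) (f : {mpoly R[d]}) : Prop :=
  (msize f <= n.+1)%N.

(* The zero matrix (like an empty one) has no degree. *)
Definition polymx_degree (R : realType) (d m n : nat)
    (A : 'M[{mpoly R[d]}]_(m, n)) (k : nat) : Prop :=
  (\max_i \max_j msize (A i j))%N = k.+1.

Definition hdim (d n : nat) : nat := 'C((n + d).-1, n).

(* [map_mx u M] is the matrix <u, M> of the moment functional [u]. *)
Definition moment_functional (R : realType) (d : nat) := {scalar {mpoly R[d]}}.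

(* The basis of the polynomials of degree at most [n] is indexed by the pairs
   (k, i) with k <= n and i < hdim d k. *)
Definition polynomial_system (R : realType) (d : nat)
    (P : forall n, 'cV[{mpoly R[d]}]_(hdim d n)) : Prop :=
  (forall n i, msize (P n i 0) = n.+1) /\
  (forall n, is_basis (@poly_deg_le R d n)
     (fun t : {k : 'I_n.+1 & 'I_(hdim d k)} => P (tag t) (tagged t) 0)).

Definition wops (R : realType) (d : nat) (u : moment_functional R d)
    (P : forall n, 'cV[{mpoly R[d]}]_(hdim d n)) : Prop :=
  [/\ polynomial_system P,
      forall n m, m <> n -> map_mx u (P n *m (P m)^T) = 0
    & forall n, map_mx u (P n *m (P n)^T) \in unitmx].

Definition quasi_definite (R : realType) (d : nat)
    (u : moment_functional R d) : Prop :=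
  exists P : forall n, 'cV[{mpoly R[d]}]_(hdim d n), wops u P.

Definition grad (R : realType) (d : nat) (f : {mpoly R[d]}) :
    'cV[{mpoly R[d]}]_d :=
  \col_i mderiv i f.

Definition grad_row (R : realType) (d r : nat) (v : 'rV[{mpoly R[d]}]_r) :
    'M[{mpoly R[d]}]_(d, r) :=
  \matrix_(i, j) mderiv i (v 0 j).

Definition pearson (R : realType) (d : nat) (u : moment_functional R d)
    (Phi : 'M[{mpoly R[d]}]_d) (Psi : 'cV[{mpoly R[d]}]_d) : Prop :=
  forall f : {mpoly R[d]}, map_mx u (Phi *m grad f + f *: Psi) = 0.

Definition semiclassical_with (R : realType) (d : nat)
    (u : moment_functional R d) (Phi : 'M[{mpoly R[d]}]_d)
    (Psi : 'cV[{mpoly R[d]}]_d) (p q : nat) : Prop :=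
  [/\ Phi^T = Phi,
      polymx_degree Phi p,
      polymx_degree Psi q /\ (1 <= q)%N,
      \det (map_mx u Phi) != 0
    & pearson u Phi Psi].

Definition semiclassical (R : realType) (d : nat)
    (u : moment_functional R d) : Prop :=
  quasi_definite u /\
  exists (Phi : 'M[{mpoly R[d]}]_d) (Psi : 'cV[{mpoly R[d]}]_d) (p q : nat),
    semiclassical_with u Phi Psi p q.

Definition gradients_quasi_orthogonal (R : realType) (d : nat)
    (u : moment_functional R d) (Phi : 'M[{mpoly R[d]}]_d)
    (P : forall n, 'cV[{mpoly R[d]}]_(hdim d n)) (s : nat) : Prop :=
  forall n m, (s.+1 <= n)%N -> (m < n - s)%N ->
    map_mx u ((grad_row (P m)^T)^T *m Phi *m grad_row (P n)^T) = 0.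

(* Main.v *)
Require Import Defs.
From HB Require Import structures.
From mathcomp Require Import all_boot all_algebra.
From mathcomp Require Import reals.
From mathcomp Require Import mpoly.
From mathcomp Require Import zify.

(** Write B(f, g) for <u, (grad f)^t Phi grad g>, and let F_k(f) be the k-th
    component of <u, Phi grad f>.  The equation div(Phi u) = Psi^t u says that
    F_k(f) = - <u, f Psi_k> for all f and k.

    If it holds, applying it to the products (d_k f) g and summing over k
    integrates by parts ([gradform_by_parts]): B(f, g) = - <u, g D f>, where
    D f = sum_(k, l) Phi_kl d_l d_k f + sum_k Psi_k d_k f.  As D raises the
    degree by at most s = max(p - 2, q - 1), and an entry of P_n is orthogonal
    to every polynomial of degree less than n ([wops_lowdeg]), B vanishes on
    P_m and P_n when m + s < n.

    Conversely, F_k(g) = B(x_k, g), and x_k lies in the span of P_0 and P_1, so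
    quasi-orthogonality makes F_k vanish on P_n for all n >= s + 2.  A linear
    functional which vanishes on all but finitely many P_n has the form
    f |-> <u, psi f> for a polynomial psi, since the matrices <u, P_n P_n^t>
    are invertible ([wops_representation]); this gives Psi.  It remains to see
    that Psi is not constant: otherwise F_k would vanish on P_1, and trivially
    on P_0, hence on every x_l; but F_k(x_l) = <u, Phi_kl>, and <u, Phi> is
    invertible. *)

Set Implicit Arguments.
Unset Strict Implicit.
Unset Printing Implicit Defensive.

Import GRing.Theory.
Local Open Scope ring_scope.

(** * Total degree *)

Lemma msize_mderiv (R : realType) (d : nat) (i : 'I_d) (f : {mpoly R[d]}) :
  (msize (mderiv i f) <= (msize f).-1)%N.
Proof.
rewrite [X in (X <= _)%N]msizeE; apply/bigmax_leqP_seq => m + _.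
rewrite mcoeff_msupp mcoeff_mderiv => h.
have : (m + U_(i))%MM \in msupp f.
  by rewrite mcoeff_msupp; apply: contraNneq h => ->; rewrite mul0rn.
by move/msize_mdeg_lt; rewrite mdegD mdeg1 addn1; case: (msize f).
Qed.

Lemma msizeM_leq (R : realType) (d : nat) (f g : {mpoly R[d]}) :
  (msize (f * g) <= (msize f + msize g).-1)%N.
Proof.
have [->|f0] := eqVneq f 0; first by rewrite mul0r msize0.
have [->|g0] := eqVneq g 0; first by rewrite mulr0 msize0.
by rewrite msizeM.
Qed.

Lemma msize_sum_leq (R : realType) (d : nat) (I : finType)
    (F : I -> {mpoly R[d]}) (n : nat) :
  (forall i, msize (F i) <= n)%N -> (msize (\sum_i F i) <= n)%N.
Proof.
move=> h; apply: leq_trans (msize_sum _ _ _) _.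
by apply/bigmax_leqP => i _; apply: h.
Qed.

Lemma polymx_degree_entry (R : realType) (d m n : nat)
    (A : 'M[{mpoly R[d]}]_(m, n)) (k : nat) :
  polymx_degree A k -> forall i j, (msize (A i j) <= k.+1)%N.
Proof.
rewrite /polymx_degree => <- i j.
apply: leq_trans (leq_bigmax i).
exact: (leq_bigmax (F := fun j => msize (A i j)) j).
Qed.

Lemma polymx_degree_pos (R : realType) (d m n : nat)
    (A : 'M[{mpoly R[d]}]_(m, n)) (i : 'I_m) (j : 'I_n) :
  (1 < msize (A i j))%N ->
  exists k, polymx_degree A k /\ (1 <= k)%N.
Proof.
move=> h; set M := (\max_i \max_j msize (A i j))%N.
have hM : (1 < M)%N.
  apply: leq_trans h _; apply: leq_trans (leq_bigmax i).
  exact: (leq_bigmax (F := fun j => msize (A i j)) j).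
exists M.-1; split; last by case: M hM => [|[|]].
by rewrite /polymx_degree -/M; case: M hM.
Qed.

(** * Expansion along a weak orthogonal polynomial system *)

(** A polynomial system up to degree N - 1 detects linear functionals on the
    polynomials of degree less than N; for N = 0 the only such polynomial
    is 0. *)
Lemma scalar_eq0_system (R : realType) (d : nat)
    (P : forall n, 'cV[{mpoly R[d]}]_(hdim d n)) (T : {scalar {mpoly R[d]}})
    (N : nat) :
  polynomial_system P ->
  (forall n i, (n < N)%N -> T (P n i 0) = 0) ->
  forall f, (msize f <= N)%N -> T f = 0.
Proof.
case=> _ hb hT f; case: N hT => [|N] hT hf.
  have /eqP -> : f == 0 by rewrite -msize_poly_eq0 -leqn0.
  by rewrite linear0.
case: (hb N) => _ _ /(_ f hf) [c ->].
rewrite linear_sum big1 // => -[k i] _ /=.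
by rewrite linearZ /= hT ?mulr0.
Qed.

Lemma wops_ortho (R : realType) (d : nat) (u : moment_functional R d)
    (P : forall n, 'cV[{mpoly R[d]}]_(hdim d n)) :
  wops u P -> forall n m i j, m <> n -> u (P n i 0 * P m j 0) = 0.
Proof.
case=> _ h _ n m i j /h /matrixP /(_ i j).
by rewrite !mxE big_ord1 !mxE.
Qed.

(** The functional g u, that is f |-> <u, g f>. *)
Definition mulfun (R : realType) (d : nat) (u : moment_functional R d)
  (g f : {mpoly R[d]}) : R := u (g * f).

Lemma mulfun_is_scalar (R : realType) (d : nat) (u : moment_functional R d)
  (g : {mpoly R[d]}) : scalar (mulfun u g).
Proof.
by move=> a f h; rewrite /mulfun mulrDr -scalerAr linearP.
Qed.

HB.instance Definition _ (R : realType) (d : nat) (u : moment_functional R d)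
  (g : {mpoly R[d]}) :=
  GRing.isLinear.Build R {mpoly R[d]} R *%R (mulfun u g) (mulfun_is_scalar u g).

Lemma wops_lowdeg (R : realType) (d : nat) (u : moment_functional R d)
    (P : forall n, 'cV[{mpoly R[d]}]_(hdim d n)) :
  wops u P -> forall n i f, (msize f <= n)%N -> u (P n i 0 * f) = 0.
Proof.
move=> hP n i f hf; case: (hP) => hs _ _.
apply: (scalar_eq0_system (T := mulfun u (P n i 0)) hs) hf => m j lt_mn.
by apply: (wops_ortho hP) => e; rewrite e ltnn in lt_mn.
Qed.

(** A functional whose Fourier coefficients against the system vanish from
    index N on is the multiple psi u of [u] by its finite Fourier sum psi. *)
Lemma wops_representation (R : realType) (d : nat) (u : moment_functional R d)
    (P : forall n, 'cV[{mpoly R[d]}]_(hdim d n)) (T : {scalar {mpoly R[d]}})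
    (N : nat) :
  wops u P -> (forall n i, (N <= n)%N -> T (P n i 0) = 0) ->
  exists psi, forall f, T f = u (psi * f).
Proof.
move=> hP hT; case: (hP) => hs _ hH.
(* The row a n solves a n *m H n = T (P n)^T. *)
pose H n := map_mx u (P n *m (P n)^T).
pose a n := (\row_i T (P n i 0)) *m invmx (H n).
have HE n i j : u (P n i 0 * P n j 0) = H n i j.
  by rewrite !mxE big_ord1 !mxE.
have ha n j : \sum_i a n 0 i * u (P n i 0 * P n j 0) = T (P n j 0).
  under eq_bigr do rewrite HE.
  have := mulmxKV (hH n) (\row_i T (P n i 0)).
  by move/matrixP/(_ 0 j); rewrite [LHS]mxE [RHS]mxE.
pose psi := \sum_(n < N) \sum_i a n 0 i *: P n i 0.
have uE m j : u (psi * P m j 0) =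
    \sum_(n < N) \sum_i a n 0 i * u (P n i 0 * P m j 0).
  rewrite mulr_suml linear_sum; apply: eq_bigr => n _ /=.
  rewrite mulr_suml linear_sum; apply: eq_bigr => i _ /=.
  by rewrite -scalerAl linearZ.
exists psi => f; apply/eqP; rewrite eq_sym -subr_eq0 -[u _]/(mulfun u psi f).
pose D : {scalar {mpoly R[d]}} := (mulfun u psi \- T)%R.
rewrite -[_ - _]/(D f); apply/eqP.
apply: (scalar_eq0_system (T := D) hs) (leqnn _) => m j _.
rewrite /D /= /mulfun uE.
case: (ltnP m N) => hm; last first.
  rewrite hT // subr0 big1 // => n _; rewrite big1 // => i _.
  rewrite (wops_ortho hP) ?mulr0 // => e.
  by move: (ltn_ord n); rewrite -e ltnNge hm.
rewrite (bigD1 (Ordinal hm)) //= ha big1 ?addr0 ?subrr // => n hn.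
rewrite big1 // => i _; rewrite (wops_ortho hP) ?mulr0 // => e.
by case/eqP: hn; apply: val_inj.
Qed.

(** * The bilinear form of the gradients *)

(** The bilinear form <u, (grad f)^t Phi grad g>. *)
Definition gradform (R : realType) (d : nat) (u : moment_functional R d)
    (Phi : 'M[{mpoly R[d]}]_d) (f g : {mpoly R[d]}) : R :=
  \sum_k \sum_l u (mderiv k f * Phi k l * mderiv l g).

Lemma gradform_entry (R : realType) (d r s : nat) (u : moment_functional R d)
    (Phi : 'M[{mpoly R[d]}]_d) (v : 'cV[{mpoly R[d]}]_r)
    (w : 'cV[{mpoly R[d]}]_s) i j :
  map_mx u ((grad_row v^T)^T *m Phi *m grad_row w^T) i j =
  gradform u Phi (v i 0) (w j 0).
Proof.
rewrite !mxE linear_sum /gradform exchange_big; apply: eq_bigr => l _ /=.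
rewrite !mxE mulr_suml linear_sum; apply: eq_bigr => k _ /=.
by rewrite !mxE.
Qed.

(** The k-th component of <u, Phi grad f>. *)
Definition flux (R : realType) (d : nat) (u : moment_functional R d)
    (Phi : 'M[{mpoly R[d]}]_d) (k : 'I_d) (f : {mpoly R[d]}) : R :=
  \sum_l u (Phi k l * mderiv l f).

Lemma flux_is_scalar (R : realType) (d : nat) (u : moment_functional R d)
  (Phi : 'M[{mpoly R[d]}]_d) (k : 'I_d) : scalar (flux u Phi k).
Proof.
move=> a f g; rewrite /flux mulr_sumr -big_split; apply: eq_bigr => l _ /=.
by rewrite linearP mulrDr -scalerAr linearP.
Qed.

HB.instance Definition _ (R : realType) (d : nat) (u : moment_functional R d)
  (Phi : 'M[{mpoly R[d]}]_d) (k : 'I_d) :=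
  GRing.isLinear.Build R {mpoly R[d]} R *%R (flux u Phi k)
    (flux_is_scalar u Phi k).

(** The matrix Pearson equation, component by component. *)
Lemma pearsonP (R : realType) (d : nat) (u : moment_functional R d)
    (Phi : 'M[{mpoly R[d]}]_d) (Psi : 'cV[{mpoly R[d]}]_d) :
  pearson u Phi Psi <-> forall k f, flux u Phi k f + u (f * Psi k 0) = 0.
Proof.
have E f k : map_mx u (Phi *m grad f + f *: Psi) k 0 =
    flux u Phi k f + u (f * Psi k 0).
  rewrite !mxE linearD linear_sum /=; congr (_ + _).
  by apply: eq_bigr => l _; rewrite !mxE.
split=> [h k f|h f]; first by rewrite -E h mxE.
by apply/matrixP => k j; rewrite ord1 E h mxE.
Qed.

(** Integration by parts: the Pearson equation turns the gradient form into
    minus the pairing of [g] with the second-order differential operator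
    applied to [f]. *)
Lemma gradform_by_parts (R : realType) (d : nat) (u : moment_functional R d)
    (Phi : 'M[{mpoly R[d]}]_d) (Psi : 'cV[{mpoly R[d]}]_d) f g :
  pearson u Phi Psi ->
  gradform u Phi f g =
  - u (g * \sum_k (\sum_l Phi k l * mderiv l (mderiv k f)
                   + Psi k 0 * mderiv k f)).
Proof.
move/pearsonP => h; apply/eqP; rewrite -addr_eq0; apply/eqP.
rewrite /gradform mulr_sumr linear_sum -big_split big1 //= => k _.
(* The Pearson equation is applied to (d_k f) g. *)
rewrite -[RHS](h k (mderiv k f * g)) /flux mulrDr linearD /= addrA.
congr (_ + _); last by congr (u _); rewrite mulrC -mulrA mulrC.
rewrite mulr_sumr linear_sum -big_split; apply: eq_bigr => l _ /=.
rewrite -linearD mderivM; congr (u _).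
rewrite addrC mulrDr; congr (_ + _); first by rewrite mulrC -mulrA.
by rewrite [_ * Phi k l]mulrC mulrA.
Qed.

Lemma mderiv_var (R : realType) (d : nat) (k l : 'I_d) :
  mderiv k ('X_l : {mpoly R[d]}) = (k == l)%:R.
Proof.
rewrite mderivX mnm1E eq_sym; have [->|_] := eqVneq k l.
  by rewrite -[X in (X - _)%MM]add0m addmK mpolyX0 scale1r.
by rewrite scale0r.
Qed.

Lemma gradformX (R : realType) (d : nat) (u : moment_functional R d)
    (Phi : 'M[{mpoly R[d]}]_d) (k : 'I_d) g :
  gradform u Phi 'X_k g = flux u Phi k g.
Proof.
rewrite /gradform /flux (bigD1 k) //=.
rewrite [X in _ + X]big1 ?addr0 => [|j /negPf hj].
  by apply: eq_bigr => l _; rewrite mderiv_var eqxx mul1r.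
by rewrite big1 // => l _; rewrite mderiv_var hj !mul0r linear0.
Qed.

Lemma fluxX (R : realType) (d : nat) (u : moment_functional R d)
    (Phi : 'M[{mpoly R[d]}]_d) (k l : 'I_d) :
  flux u Phi k 'X_l = map_mx u Phi k l.
Proof.
rewrite /flux mxE (bigD1 l) //= [X in _ + X]big1 ?addr0 => [|j /negPf hj].
  by rewrite mderiv_var eqxx mulr1.
by rewrite mderiv_var hj mulr0 linear0.
Qed.

(** The gradient form as a functional of its first argument. *)
Definition gradforml (R : realType) (d : nat) (u : moment_functional R d)
    (Phi : 'M[{mpoly R[d]}]_d) (g f : {mpoly R[d]}) : R :=
  gradform u Phi f g.

Lemma gradforml_is_scalar (R : realType) (d : nat) (u : moment_functional R d)
  (Phi : 'M[{mpoly R[d]}]_d) (g : {mpoly R[d]}) : scalar (gradforml u Phi g).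
Proof.
move=> a f h; rewrite /gradforml /gradform mulr_sumr -big_split.
apply: eq_bigr => k _ /=; rewrite mulr_sumr -big_split.
apply: eq_bigr => l _ /=.
by rewrite linearP !mulrDl -!scalerAl linearP.
Qed.

HB.instance Definition _ (R : realType) (d : nat) (u : moment_functional R d)
  (Phi : 'M[{mpoly R[d]}]_d) (g : {mpoly R[d]}) :=
  GRing.isLinear.Build R {mpoly R[d]} R *%R (gradforml u Phi g)
    (gradforml_is_scalar u Phi g).

(** * The two implications *)

Lemma pearson_quasi_orthogonal (R : realType) (d : nat)
    (u : moment_functional R d)
    (P : forall n, 'cV[{mpoly R[d]}]_(hdim d n))
    (Phi : 'M[{mpoly R[d]}]_d) (Psi : 'cV[{mpoly R[d]}]_d) (p q : nat) :
  wops u P -> polymx_degree Phi p -> polymx_degree Psi q -> (1 <= q)%N ->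
  pearson u Phi Psi ->
  gradients_quasi_orthogonal u Phi P (maxn (p - 2) (q - 1)).
Proof.
move=> hP hp hq q1 hu n m _ lt_mn; case: (hP) => -[hdeg _] _ _.
set s := maxn _ _ in lt_mn.
have [hps hqs] : (p <= s.+2 /\ q <= s.+1)%N by rewrite /s; lia.
have hms : (m + s < n)%N by clearbody s; lia.
apply/matrixP => i j; rewrite gradform_entry mxE.
rewrite (gradform_by_parts _ _ hu) (wops_lowdeg hP) ?oppr0 //.
apply: leq_trans hms; set f := P m i 0.
have hf k : (msize (mderiv k f) <= m)%N.
  by apply: (leq_trans (msize_mderiv k f)); rewrite hdeg.
apply: msize_sum_leq => k; apply: (leq_trans (msizeD_le _ _)).
rewrite geq_max; apply/andP; split.
  apply: msize_sum_leq => l; have := msize_mderiv l (mderiv k f).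
  have := hf k.
  (* A nonzero second derivative forces m >= 2, and the degree of its product
     with Phi k l is then at most p + m - 2. *)
  set h := mderiv l _ => h1 h2; have [->|h0] := eqVneq h 0.
    by rewrite mulr0 msize0.
  have : (0 < msize h)%N by rewrite lt0n msize_poly_eq0.
  have := msizeM_leq (Phi k l) h; have := polymx_degree_entry hp k l.
  lia.
have [->|h0] := eqVneq (mderiv k f) 0; first by rewrite mulr0 msize0.
have : (0 < msize (mderiv k f))%N by rewrite lt0n msize_poly_eq0.
have := msizeM_leq (Psi k 0) (mderiv k f); have := polymx_degree_entry hq k 0.
have := hf k; lia.
Qed.

Lemma quasi_orthogonal_pearson (R : realType) (d : nat)
    (u : moment_functional R d)
    (P : forall n, 'cV[{mpoly R[d]}]_(hdim d n))
    (Phi : 'M[{mpoly R[d]}]_d) (s : nat) :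
  (0 < d)%N -> wops u P -> \det (map_mx u Phi) != 0 ->
  gradients_quasi_orthogonal u Phi P s ->
  exists (Psi : 'cV[{mpoly R[d]}]_d) (q : nat),
    [/\ polymx_degree Psi q, (1 <= q)%N & pearson u Phi Psi].
Proof.
move=> d0 hP hdet hqo; case: (hP) => hs _ _.
have hflux k n i : (s.+2 <= n)%N -> flux u Phi k (P n i 0) = 0.
  move=> hn; rewrite -gradformX -[LHS]/(gradforml u Phi (P n i 0) 'X_k).
  (* 'X_k has degree 1, so only m = 0 and m = 1 occur below. *)
  pose T := gradforml u Phi (P n i 0) : {scalar {mpoly R[d]}}.
  apply: (scalar_eq0_system (T := T) (N := 2) hs) => [m j hm|].
    rewrite /T /= /gradforml -gradform_entry hqo ?mxE //; lia.
  by rewrite msizeX mdeg1.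
have [psi hpsi] : exists psi : 'I_d -> {mpoly R[d]},
    forall k f, flux u Phi k f = u (psi k * f).
  apply: (fin_all_exists
    (P := fun k x => forall f, flux u Phi k f = u (x * f))) => k.
  by apply: (wops_representation hP (hflux k)).
pose Psi : 'cV[{mpoly R[d]}]_d := \col_k - psi k.
have hpearson : pearson u Phi Psi.
  by apply/pearsonP => k f; rewrite mxE hpsi mulrN mulrC linearN /= subrr.
case: (pickP (fun k => 1 < msize (Psi k 0%R))%N) => [k hk|hno].
  by case: (polymx_degree_pos hk) => q [h1 h2]; exists Psi, q.
(* Psi is constant: then every flux kills P 1, which is orthogonal to the
   constants, and P 0, which has zero gradient; hence it kills each 'X_l, so
   that <u, Phi> = 0, against the hypothesis on the determinant. *)
case/negP: hdet; suff -> : map_mx u Phi = 0.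
  by rewrite -(scale0r 0) detZ expr0n eqn0Ngt d0 mul0r.
apply/matrixP => k l; rewrite -fluxX mxE.
apply: (scalar_eq0_system (T := flux u Phi k) (N := 2) hs) => [m j hm|];
  last by rewrite msizeX mdeg1.
case: m j hm => [|[|//]] j _ /=.
  rewrite /flux big1 // => i _.
  have /msize1_polyC -> : (msize (P 0%N j 0%R) <= 1)%N by case: hs => ->.
  by rewrite mderivC mulr0 linear0.
rewrite hpsi mulrC (wops_lowdeg hP) //.
by move: (hno k); rewrite mxE mmeasureN ltnNge => /negbFE.
Qed.

Theorem theorem3p3 (R : realType) (d : nat) (hd : (0 < d)%N)
    (u : moment_functional R d) (hu : quasi_definite u)
    (P : forall n, 'cV[{mpoly R[d]}]_(hdim d n)) (hP : wops u P) :
  (forall (Phi : 'M[{mpoly R[d]}]_d) (Psi : 'cV[{mpoly R[d]}]_d) (p q : nat),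
     semiclassical_with u Phi Psi p q ->
     gradients_quasi_orthogonal u Phi P (maxn (p - 2) (q - 1))) /\
  ((exists (Phi : 'M[{mpoly R[d]}]_d) (p s : nat),
      [/\ Phi^T = Phi,
          polymx_degree Phi p,
          \det (map_mx u Phi) != 0,
          (maxn (p - 2) 0 <= s)%N
        & gradients_quasi_orthogonal u Phi P s]) ->
   semiclassical u).
Proof.
split=> [Phi Psi p q [_ hp [hq q1] _ hu']|[Phi [p [s [hT hp hdet _ hqo]]]]].
  exact: pearson_quasi_orthogonal hP hp hq q1 hu'.
split=> //; have [Psi [q [hq q1 hpear]]] :=
  quasi_orthogonal_pearson hd hP hdet hqo.
by exists Phi, Psi, p, q.
Qed.
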